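(* For each $N\geq 2$ there is a constant $A(N)>0$ such that, whenever $\lambda/\theta>A(N)$, the bias voter model $\{\eta_t\}_{t\ge0}$ on $\mathbb{T}^N$ with parameters $\lambda>\theta>0$ and initial distribution $\mu_p$, for any $p\in(0,1)$, converges weakly as $t\to\infty$ to the point mass $\delta_{\mathbf 1}$ on the configuration in which every vertex is in state $1$. Moreover the constants satisfy \[ \limsup_{N\to\infty}\frac{A(N)}{\sqrt N}\le 1. \]
   Context: $\mathbb{T}^N$ denotes the infinite regular tree in which every vertex has degree $N+1$. For a connected graph $S$ with finite degrees and constants $\lambda>\theta>0$, the bias voter model on $S$ is the spin system $\{\eta_t\}_{t\ge0}$ on $\{0,1\}^S$ with flip rate at vertex $x$ in configuration $\eta$ equal to $\frac{\lambda}{\deg(x)}\sum_{y\sim x}\eta(y)$ if $\eta(x)=0$ and $\frac{\theta}{\deg(x)}\sum_{y\sim x}(1-\eta(y))$ if $\eta(x)=1$. $\mu_p$ denotes the product Bernoulli measure with density $p$ on $\{0,1\}^S$. Weak convergence $\eta_t\Rightarrow\mu$ means $E f(\eta_t)\to\int f\,d\mu$ for every continuous $f$ on $\{0,1\}^S$ (product topology). *)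

(* Defs.v *)
From HB Require Import structures.
From mathcomp Require Import all_boot all_order all_algebra.
From mathcomp Require Import all_classical all_reals all_analysis.
Set Implicit Arguments. Unset Strict Implicit. Unset Printing Implicit Defensive.
Import Order.TTheory GRing.Theory Num.Theory.
Import numFieldNormedType.Exports.
Local Open Scope ring_scope.
Local Open Scope classical_set_scope.

(* The regular tree T^N (every vertex has degree N+1).                *)
(* Vertices are words: the root is [::]; the root has the N+1 children *)
(* [:: i] (i < N+1); a non-root vertex s has the N children rcons s i  *)
(* (i < N).  Its neighbours are its parent and its children.           *)
Definition tree_word (N : nat) (s : seq nat) : bool :=
  match s with
  | [::] => true
  | a :: t => (a < N.+1)%N && all (fun i => (i < N)%N) t
  end.

Definition tree (N : nat) := {s : seq nat | tree_word N s}.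

Definition tree_nbrs (N : nat) (x : tree N) : seq (tree N) :=
  let s := val x in
  pmap insub
    ((if s is [::] then [::] else [:: take (size s).-1 s])
       ++ [seq rcons s i | i <- iota 0 N.+1]).

(* Configurations are V -> bool (true = state 1).                      *)
Section BiasVoter.
Variables (R : realType) (V : eqType) (nbrs : V -> seq V).

Definition flip (x : V) (eta : V -> bool) : V -> bool :=
  fun y => if y == x then ~~ eta x else eta y.

Definition deg (x : V) : R := (size (nbrs x))%:R.

Definition bv_rate (lam th : R) (x : V) (eta : V -> bool) : R :=
  if eta x then th / deg x * (count (fun y => ~~ eta y) (nbrs x))%:R
  else lam / deg x * (count eta (nbrs x))%:R.

Definition depends_on (F : seq V) (f : (V -> bool) -> R) : Prop :=
  forall eta zeta : V -> bool, {in F, eta =1 zeta} -> f eta = f zeta.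

(* the generator applied to a function depending only on F: flips
   outside F do not change f, so this is the full generator sum *)
Definition bv_gen (lam th : R) (F : seq V) (f : (V -> bool) -> R)
  (eta : V -> bool) : R :=
  \sum_(x <- F) bv_rate lam th x eta * (f (flip x eta) - f eta).

Definition pcont (f : (V -> bool) -> R) : Prop :=
  let g : {ptws V -> bool} -> R := f in continuous g.

(* T is the (Feller) Markov semigroup of the bias voter model:
   a strongly continuous positive linear conservative semigroup on the
   continuous functions of {0,1}^V (product topology) whose generator
   agrees with the bias-voter generator on cylinder functions.  By
   Liggett (Thm I.3.9) such a semigroup exists and is unique, and
   E^{mu} f(eta_t) = int (T t f) d mu. *)
Definition bv_semigroup (lam th : R)
  (T : R -> ((V -> bool) -> R) -> ((V -> bool) -> R)) : Prop :=
  (forall t f, 0 <= t -> pcont f -> pcont (T t f)) /\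
      (forall f, pcont f -> T 0 f = f) /\
      (forall t s f, 0 <= t -> 0 <= s -> pcont f -> T (t + s) f = T t (T s f)) /\
      (forall t f g c, 0 <= t -> pcont f -> pcont g ->
        T t (fun eta => f eta + c * g eta) =
        (fun eta => T t f eta + c * T t g eta)) /\
      (forall t f, 0 <= t -> pcont f -> (forall eta, 0 <= f eta) ->
        forall eta, 0 <= T t f eta) /\
      (forall t, 0 <= t -> T t (fun _ => 1) = (fun _ => 1)) /\
      (forall f, pcont f -> forall e, 0 < e -> exists2 d, 0 < d &
        forall h eta, 0 <= h -> h < d -> `|T h f eta - f eta| < e) /\
      (forall F f, uniq F -> depends_on F f -> forall e, 0 < e -> exists2 d, 0 < d &
        forall h eta, 0 < h -> h < d ->
          `|(T h f eta - f eta) / h - bv_gen lam th F f eta| < e).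

Definition coord_sets : set (set (V -> bool)) :=
  [set A | exists x b, A = [set eta | eta x = b]].

Definition config := g_sigma_algebraType coord_sets.

Definition bernoulli_product (p : R) (mu : set config -> \bar R) : Prop :=
  forall l : seq (V * bool), uniq (map fst l) ->
    mu [set eta | forall xb, xb \in l -> eta xb.1 = xb.2] =
    (\prod_(xb <- l) (if xb.2 then p else 1 - p))%:E.

End BiasVoter.

(* Main.v *)
Require Import Defs.
From HB Require Import structures.
From mathcomp Require Import all_boot all_order all_algebra finmap.
From mathcomp Require Import all_classical all_reals all_analysis.
From mathcomp Require Import ring lra zify.
Set Implicit Arguments. Unset Strict Implicit. Unset Printing Implicit Defensive.
Import Order.TTheory GRing.Theory Num.Theory.
Import numFieldNormedType.Exports.
Local Open Scope ring_scope.
Local Open Scope classical_set_scope.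

(* For a finite set A let H_A(eta) be the indicator that eta vanishes on A. The
   biased voter generator applied to H_A is the generator, acting on A, of a
   coalescing branching random walk: particles jump to a neighbour at rate th
   and give birth on a neighbour at rate lam - th. In a tree a set of n vertices
   spans fewer than n edges, so the walk with n particles gains a particle at
   rate at least (lam - th) (N - 1) n / (N + 1) and loses one at rate at most
   2 th n / (N + 1). Hence, if lam > 7 th, the function 1 / (n + 1) decays
   exponentially under the dual semigroup. Since (1 - p)^n <= 1 / (p (n + 1)),
   the probability that eta_t vanishes on A tends to 0 exponentially fast, and
   continuous functions are controlled by finitely many vertices. Thus A(N) can
   be taken to be the constant 7. *)

(** * Continuous functions of a configuration *)

Section Configurations.
Variables (R : realType) (V : countType).
Implicit Types (f g : (V -> bool) -> R) (eta zeta : V -> bool) (F : seq V).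

Lemma depends_on_pcont F f : depends_on F f -> pcont f.
Proof.
move=> fF g eta U /nbhs_singleton; rewrite {}/g => Uf.
pose NE : set_system {ptws V -> bool} := nbhs (eta : {ptws V -> bool}).
have NEF : Filter NE by exact: nbhs_filter.
suff : NE [set zeta | {in F, eta =1 zeta}].
  by apply: (@filterS _ NE) => zeta /fF /= <-.
elim: F {fF} => [|x F IH]; first by apply: (@filterE _ NE) => zeta y; rewrite in_nil.
have xP : NE [set zeta | eta x = zeta x].
  exact: (@proj_continuous V (fun=> bool) x eta [set b | eta x = b]).
apply: (@filterS2 _ NE _ _ _ _ _ xP IH) => zeta ex eF y.
by rewrite in_cons => /orP[/eqP ->|/eF].
Qed.

Lemma pcont_cst (c : R) : pcont (fun _ : V -> bool => c).
Proof. exact: (@depends_on_pcont [::]). Qed.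

Lemma pcontD f g (c : R) :
  pcont f -> pcont g -> pcont (fun eta => f eta + c * g eta).
Proof.
move=> cf cg; rewrite /pcont /= => eta.
pose NE : set_system {ptws V -> bool} := nbhs (eta : {ptws V -> bool}).
have NEF : Filter NE by exact: nbhs_filter.
apply: (@cvgD _ _ _ NE _ f (fun zeta => c * g zeta)); first exact: cf.
by apply: (@cvgMl_tmp _ _ NE _ g); exact: cg.
Qed.

Lemma pcont_sum (I : Type) (r : seq I) (G : I -> (V -> bool) -> R) :
  (forall i, pcont (G i)) -> pcont (fun eta => \sum_(i <- r) G i eta).
Proof.
move=> cG; elim: r => [|i r IH].
  rewrite (_ : (fun _ => _) = fun=> 0); first exact: pcont_cst.
  by apply: funext => eta; rewrite big_nil.
rewrite (_ : (fun _ => _) = fun eta => G i eta + 1 * \sum_(j <- r) G j eta).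
  exact: pcontD.
by apply: funext => eta; rewrite big_cons mul1r.
Qed.

Lemma pcont_cvg f (u : nat -> V -> bool) eta : pcont f ->
  (forall x, \forall n \near \oo, u n x = eta x) -> f (u n) @[n --> \oo] --> f eta.
Proof.
move=> cf ux; have : {ptws, u @ \oo --> eta}.
  apply/cvg_sup => x U [W] [[Z] oZ <-] /= Zx WU; apply: filterS WU _.
  by have : \forall n \near \oo, Z (u n x) by apply: filterS (ux x) => n ->.
by move=> ueta; exact: (cvg_comp _ _ ueta (cf eta)).
Qed.

Lemma pcont_bounded f : pcont f -> exists2 M : R, 0 < M & forall eta, `|f eta| <= M.
Proof.
move=> cf.
have cT : compact [set: {ptws V -> bool}].
  have := @tychonoff V (fun=> bool) (fun=> setT) (fun=> bool_compact).
  by congr compact; apply/seteqP; split.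
have /compact_bounded/ex_strict_bound_gt0[M M0 fM] :
    compact (f @` [set: {ptws V -> bool}]).
  apply: continuous_compact cT; apply: continuous_subspaceT; exact: cf.
by exists M => // eta; apply: ltW; apply: fM; exists eta.
Qed.

Lemma measurable_coord (x : V) :
  measurable_fun [set: config V] (fun eta : config V => eta x).
Proof.
move=> _ B _; rewrite setTI.
have mb b : measurable ([set eta | eta x = b] : set (config V)).
  by apply: sub_gen_smallest; exists x, b.
rewrite (_ : _ @^-1` B = \bigcup_(b in B) [set eta | eta x = b]).
  apply: fin_bigcup_measurable; first exact: finite_finset.
  by move=> b _; exact: mb.
apply/seteqP; split=> [eta /= Beta|eta [b Bb /= xb]]; last by rewrite /preimage /= xb.
by exists (eta x).
Qed.

Lemma depends_on_measurable F f :
  depends_on F f -> measurable_fun [set: config V] (f : config V -> R).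
Proof.
elim: F f => [|x F IH] f fF.
  suff -> : f = cst (f (fun=> true)) by exact: measurable_cst.
  by apply: funext => eta; apply: fF.
pose upd b (eta : V -> bool) := fun y => if y == x then b else eta y.
rewrite (_ : f = fun eta => if eta x then f (upd true eta) else f (upd false eta)).
  have mf b : measurable_fun [set: config V] (fun eta : config V => f (upd b eta)).
    apply: (IH (f \o upd b)) => eta zeta e /=; apply: fF => y.
    rewrite in_cons /upd; case: eqP => //= _; exact: e.
  by apply: measurable_fun_ifT => //; exact: measurable_coord.
apply: funext => eta; case ex : (eta x); congr f; apply: funext => y;
  by rewrite /upd; case: eqP => // ->.
Qed.

Lemma pcont_measurable f :
  pcont f -> measurable_fun [set: config V] (f : config V -> R).
Proof.
move=> cf; pose cut n eta : V -> bool := fun x => (choice.pickle x < n)%N && eta x.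
apply: (@measurable_realfun.measurable_fun_cvg _ (config V) R setT
  (fun n eta => f (cut n eta))).
  move=> n; apply: (@depends_on_measurable (pmap choice.unpickle (iota 0 n)) (f \o cut n)).
  move=> eta zeta e /=; congr f; apply: funext => x; rewrite /cut.
  have [xn|//] := ltnP (choice.pickle x) n; apply: e.
  by rewrite mem_pmap; apply/mapP; exists (choice.pickle x);
    rewrite ?choice.pickleK // mem_iota.
move=> eta _; apply: pcont_cvg => // x; exists (choice.pickle x).+1 => // n /= xn.
by rewrite /cut xn.
Qed.

Lemma pcont_nbhd f eta (e : R) : pcont f -> 0 < e ->
  exists F : seq V, forall zeta, {in F, zeta =1 eta} -> `|f zeta - f eta| < e.
Proof.
move=> cf e0; apply: contrapT => /forallNP H.
have {}H n : exists zeta, {in pmap choice.unpickle (iota 0 n), zeta =1 eta} /\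
    e <= `|f zeta - f eta|.
  have /existsNP[zeta /not_implyP[zF /negP]] := H (pmap choice.unpickle (iota 0 n)).
  by rewrite -leNgt => ez; exists zeta.
have [u Hu] := choice H.
have /cvgrPdist_lt/(_ e e0) [n _ /(_ n (leqnn n))] : f (u n) @[n --> \oo] --> f eta.
  apply: pcont_cvg => // x; exists (choice.pickle x).+1 => // n /= xn.
  apply: (Hu n).1; rewrite mem_pmap; apply/mapP.
  by exists (choice.pickle x); rewrite ?choice.pickleK // mem_iota.
by rewrite distrC ltNge (Hu n).2.
Qed.

Lemma pcont_integrable (mu : probability (config V) R) f :
  pcont f -> mu.-integrable setT (EFin \o (f : config V -> R)).
Proof.
move=> cf; apply: measurable_bounded_integrable => //.
- by apply: (@le_lt_trans _ _ 1%E); [exact: probability_le1|rewrite ltry].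
- exact: pcont_measurable.
- have [M M0 fM] := pcont_bounded cf.
  exists M; split; first exact: gtr0_real.
  by move=> r Mr eta _; apply: le_trans (fM eta) (ltW Mr).
Qed.

End Configurations.

Arguments depends_on_pcont {R V F f} _.
Arguments pcontD {R V f g} c _ _.
Arguments pcont_sum {R V I} r {G} _.

(** * The dual process *)

Section Dual.
Variables (R : realType) (V : countType) (nbrs : V -> seq V) (N : nat).
Variables (lam th : R).
Implicit Types (A B : {fset V}) (phi psi : {fset V} -> R).
Hypothesis th_gt0 : 0 < th.
Hypothesis th_lt_lam : th < lam.
Hypothesis size_nbrs : forall x, size (nbrs x) = N.+1.

Definition vacant A (eta : V -> bool) : R := (all (fun x => ~~ eta x) A)%:R.

Lemma depends_on_vacant A : depends_on A (vacant A).
Proof.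
move=> eta zeta e; rewrite /vacant; congr (nat_of_bool _)%:R.
by apply: eq_in_all => x /e ->.
Qed.

Lemma vacantU1 y B eta :
  vacant (y |` B)%fset eta = (~~ eta y)%:R * vacant B eta.
Proof.
rewrite /vacant -natrM mulnb; congr (nat_of_bool _)%:R.
apply/allP/andP => [H|[ey /allP H] x].
  split; first by apply: H; rewrite fset1U1.
  by apply/allP => x xB; apply: H; rewrite in_fset1U xB orbT.
by rewrite in_fset1U => /orP[/eqP->//|/H].
Qed.

Lemma vacant_flip x B eta : x \notin B -> vacant B (flip x eta) = vacant B eta.
Proof.
move=> xB; apply: depends_on_vacant => y yB; rewrite /flip.
by case: eqP => // yx; rewrite -yx yB in xB.
Qed.

Definition dual_gen phi A : R :=
  \sum_(x <- A) \sum_(y <- nbrs x)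
    (th / N.+1%:R * (phi (y |` (A `\ x))%fset - phi A) +
     (lam - th) / N.+1%:R * (phi (y |` A)%fset - phi A)).

Lemma natr_count (P : pred V) (s : seq V) :
  (count P s)%:R = \sum_(y <- s) (P y)%:R :> R.
Proof. by elim: s => [|x s IH]; rewrite ?big_nil // big_cons /= natrD IH. Qed.

Lemma bv_gen_vacant A eta :
  bv_gen nbrs lam th A (vacant A) eta = dual_gen (vacant^~ eta) A.
Proof.
apply: eq_big_seq => x xA.
have AE : A = (x |` (A `\ x))%fset by rewrite fsetD1K.
set B := (A `\ x)%fset in AE *.
have xB : x \notin B by rewrite /B in_fsetD1 eqxx.
have vflip : vacant A (flip x eta) = (eta x)%:R * vacant B eta.
  by rewrite AE vacantU1 vacant_flip // /flip eqxx negbK.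
have vA : vacant A eta = (~~ eta x)%:R * vacant B eta by rewrite {1}AE vacantU1.
under [RHS]eq_bigr do rewrite !vacantU1 vA.
rewrite vflip vA /bv_rate /deg size_nbrs !natr_count.
case: (eta x) => /=; rewrite ?mul1r ?mul0r ?subr0 ?sub0r -mulrA mulr_suml mulr_sumr;
  apply: eq_bigr => y _; case: (eta y) => /=; ring.
Qed.

Lemma dual_gen_linear (a b c : R) phi psi A :
  dual_gen (fun B => a * phi B + b * psi B + c) A =
  a * dual_gen phi A + b * dual_gen psi A.
Proof.
rewrite /dual_gen !mulr_sumr -big_split /=; apply: eq_bigr => x _.
rewrite !mulr_sumr -big_split /=; apply: eq_bigr => y _; ring.
Qed.

Lemma sum_nbrs (c : R) x : \sum_(y <- nbrs x) c = N.+1%:R * c.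
Proof.
by rewrite big_const_seq count_predT size_nbrs iter_addr_0 mulr_natl.
Qed.

Lemma sum_fset_const (c : R) A : \sum_(x <- A) c = #|` A|%:R * c.
Proof. by rewrite big_const_seq count_predT iter_addr_0 mulr_natl. Qed.

Lemma dual_gen_ge phi A : (forall B, B != fset0 -> 0 <= phi B) -> A != fset0 ->
  - (lam * #|` A|%:R * phi A) <= dual_gen phi A.
Proof.
move=> phi0 A0.
have -> : - (lam * #|` A|%:R * phi A) =
    \sum_(x <- A) \sum_(y <- nbrs x) - (lam / N.+1%:R * phi A).
  under eq_bigr do rewrite sum_nbrs.
  by rewrite sum_fset_const; field; rewrite ?pnatr_eq0.
apply: ler_sum => x _; apply: ler_sum => y _.
have U0 B : 0 <= phi (y |` B)%fset.
  by apply: phi0; apply/fset0Pn; exists y; rewrite fset1U1.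
have a0 : 0 <= th / N.+1%:R * phi (y |` (A `\ x))%fset.
  by rewrite mulr_ge0 // divr_ge0 // ltW.
have b0 : 0 <= (lam - th) / N.+1%:R * phi (y |` A)%fset.
  by rewrite mulr_ge0 // divr_ge0 // subr_ge0 ltW.
rewrite -subr_ge0; apply: le_trans (addr_ge0 a0 b0) _.
by rewrite le_eqVlt; apply/orP; left; apply/eqP; ring.
Qed.

Lemma euler_step_le phi psi A (h : R) : 0 <= h -> h * (lam * #|` A|%:R) <= 1 ->
  (forall B, B != fset0 -> phi B <= psi B) -> A != fset0 ->
  phi A + h * dual_gen phi A <= psi A + h * dual_gen psi A.
Proof.
move=> h0 hA le A0.
have chi0 B : B != fset0 -> 0 <= 1 * psi B + (-1) * phi B + 0.
  by move=> /le; rewrite mul1r mulN1r addr0 subr_ge0.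
have /(ler_wpM2l h0) := dual_gen_ge chi0 A0; rewrite dual_gen_linear.
have : 0 <= (1 - h * (lam * #|` A|%:R)) * (psi A - phi A).
  by rewrite mulr_ge0 // subr_ge0 // le.
move=> H1; rewrite -subr_ge0 => H2; rewrite -subr_ge0.
apply: le_trans (addr_ge0 H1 H2) _.
by rewrite le_eqVlt; apply/orP; left; apply/eqP; ring.
Qed.

Hypothesis nbrs_irr : forall x, x \notin nbrs x.

Definition harm A : R := (#|` A|.+1%:R)^-1.

Definition decay : R := ((lam - th) * (N%:R - 1) / 3 - 2 * th) / N.+1%:R.

Lemma dual_gen_harm A : (1 < N)%N -> A != fset0 ->
  (\sum_(x <- A) count (mem A) (nbrs x) <= 2 * #|` A|)%N ->
  dual_gen harm A <= - decay * harm A.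
Proof.
move=> N1 A0 inner; set n := #|` A|; set D : R := N.+1%:R.
have D0 : 0 < D by rewrite ltr0n.
have n0 : (0 < n)%N by rewrite cardfs_gt0.
pose al : R := th / D * (n%:R^-1 - n.+1%:R^-1).
pose be : R := (lam - th) / D * (n.+1%:R^-1 - n.+2%:R^-1).
have nR : 1 <= n%:R :> R by rewrite ler1n.
have al0 : 0 <= al.
  by rewrite mulr_ge0 ?divr_ge0 ?ltW // subr_gt0 ltf_pV2 ?posrE ?ltr0n // ltr_nat.
have be0 : 0 <= be.
  by rewrite mulr_ge0 ?divr_ge0 ?subr_ge0 ?ltW // ltf_pV2 ?posrE ?ltr0n // ltr_nat.
pose I : R := \sum_(x <- A) \sum_(y <- nbrs x) (y \in A)%:R.
have I2n : I <= 2 * n%:R.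
  rewrite -natrM; apply: le_trans (_ : (\sum_(x <- A) count (mem A) (nbrs x))%:R <= _);
    last by rewrite ler_nat.
  by rewrite natr_sum le_eqVlt; apply/orP; left; apply/eqP; apply: eq_bigr => x _;
    rewrite natr_count.
have -> : dual_gen harm A = I * (al + be) - n%:R * D * be.
  rewrite -mulrA -sum_fset_const /I mulr_suml -sumrB; apply: eq_big_seq => x xA.
  rewrite -(sum_nbrs be x) mulr_suml -sumrB; apply: eq_big_seq => y yx.
  have yxN : y != x by apply: contraNneq (nbrs_irr x) => yx'; rewrite -{1}yx'.
  have nx : n = (#|` (A `\ x)%fset|).+1 by rewrite /n (cardfsD1 x) xA.
  rewrite /harm !cardfsU1 in_fsetD1 yxN /= -/n.
  case yA : (y \in A) => /=; rewrite ?add0n ?add1n -?nx /al /be -/D; ring.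
apply: le_trans (_ : 2 * n%:R * (al + be) - n%:R * D * be <= _).
  by rewrite lerD2r ler_wpM2r // addr_ge0.
have -> : al = th / D / (n%:R * (n%:R + 1)).
  by rewrite /al -[n.+1]addn1 natrD; field; rewrite ?gt_eqF //; lra.
have -> : be = (lam - th) / D / ((n%:R + 1) * (n%:R + 2)).
  by rewrite /be -[n.+2]addn2 -[n.+1]addn1 !natrD; field; rewrite ?gt_eqF //; lra.
rewrite /decay /harm -/n -[n.+1]addn1 natrD -/D.
have DE : D = N%:R + 1 by rewrite /D -[N.+1]addn1 natrD.
rewrite -subr_ge0.
suff -> : - (((lam - th) * (N%:R - 1) / 3 - 2 * th) / D) / (n%:R + 1) -
  (2 * n%:R * (th / D / (n%:R * (n%:R + 1)) + (lam - th) / D / ((n%:R + 1) * (n%:R + 2))) -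
   n%:R * D * ((lam - th) / D / ((n%:R + 1) * (n%:R + 2)))) =
  2 * (n%:R - 1) * ((lam - th) * (N%:R - 1)) / (3 * D * ((n%:R + 1) * (n%:R + 2))).
  rewrite divr_ge0 ?mulr_ge0 ?subr_ge0 ?(ltW D0) ?(ltW th_lt_lam) //; try lra.
  by rewrite ler1n ltnW.
rewrite DE; field; rewrite ?gt_eqF //; try lra.
Qed.

Variable w : V -> R.
Hypothesis w_ge1 : forall x, 1 <= w x.
Hypothesis w_nbrs : forall x y, y \in nbrs x -> w y <= w x + 1.

Definition weight A : R := \sum_(x <- A) w x.

Lemma weightU1 y B : weight (y |` B)%fset <= w y + weight B.
Proof.
rewrite /weight; have [yB|yB] := boolP (y \in B); last by rewrite big_fsetU1.
rewrite (_ : (y |` B)%fset = B); first by rewrite ler_wpDl // (le_trans ler01).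
by apply/fsetUidPr; rewrite fsub1set.
Qed.

Lemma weight_card A : #|` A|%:R <= weight A.
Proof.
by rewrite -[X in X <= _]mulr1 -sum_fset_const; apply: ler_sum => x _.
Qed.

Lemma weight_mem A x : x \in A -> w x <= weight A.
Proof.
move=> xA; rewrite /weight (big_fsetD1 x) //= lerDl sumr_ge0 // => y _.
exact: le_trans ler01 (w_ge1 y).
Qed.

Lemma dual_gen_weight A : dual_gen weight A <= 2 * lam * weight A.
Proof.
have D0 : 0 < N.+1%:R :> R by rewrite ltr0n.
have lam0 : 0 < lam by exact: lt_trans th_lt_lam.
apply: le_trans (_ : \sum_(x <- A) \sum_(y <- nbrs x) lam / N.+1%:R * (w x + 1) <= _).
  rewrite /dual_gen [X in X <= _]big_seq [X in _ <= X]big_seq.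
  apply: ler_sum => x xA.
  rewrite [X in X <= _]big_seq [X in _ <= X]big_seq.
  apply: ler_sum => y yx.
  have WD : weight A = w x + weight (A `\ x)%fset by rewrite /weight (big_fsetD1 x).
  have wx := w_ge1 x; have wy := w_nbrs yx.
  have -> : lam / N.+1%:R * (w x + 1) = th / N.+1%:R * (w x + 1) +
    (lam - th) / N.+1%:R * (w x + 1) by ring.
  apply: lerD; apply: ler_wpM2l.
  - by rewrite divr_ge0 // ltW.
  - have := weightU1 y (A `\ x)%fset; lra.
  - by rewrite divr_ge0 // subr_ge0 ltW.
  - have := weightU1 y A; lra.
under eq_bigr do rewrite sum_nbrs.
rewrite /weight mulr_sumr; apply: ler_sum => x _.
have -> : N.+1%:R * (lam / N.+1%:R * (w x + 1)) = lam * (w x + 1).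
  by field; rewrite gt_eqF.
by have := w_ge1 x; nra.
Qed.

Hypothesis w_finite : forall m : R, exists s : seq V, forall x, w x <= m -> x \in s.

Lemma weight_finite (m : R) :
  exists s : seq {fset V}, forall A, weight A <= m -> A \in s.
Proof.
have [s sP] := w_finite m; exists (fpowerset (seq_fset tt s)) => A Am.
rewrite fpowersetE; apply/fsubsetP => x xA; rewrite seq_fsetE.
by apply: sP; apply: le_trans (weight_mem xA) Am.
Qed.

Lemma uniform_radius (T : eqType) (s : seq T) (P : T -> R -> Prop) :
  (forall a, exists2 d, 0 < d & forall h, 0 < h < d -> P a h) ->
  exists2 d, 0 < d & forall a h, a \in s -> 0 < h < d -> P a h.
Proof.
move=> H; elim: s => [|a s [d d0 IH]]; first by exists 1.
have [d' d'0 Hd'] := H a; exists (Num.min d d'); first by rewrite lt_min d0.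
move=> b h; rewrite in_cons lt_min => /orP[/eqP->|bs] /and3P[h0 hd hd'].
  by apply: Hd'; rewrite h0.
by apply: IH => //; rewrite h0.
Qed.

(* A supersolution argument. The bound [K (1 - decay h)^k harm A] is propagated
   along an Euler scheme of step [h]. The term in [weight A] makes the bound
   trivial outside a finite family of sets [A], on which the error of one
   Euler step is uniformly [o(h)]. *)
Lemma dual_decay (u : R -> {fset V} -> R) (K : R) :
  (1 < N)%N -> 0 < decay -> 0 <= K ->
  (forall A, (\sum_(x <- A) count (mem A) (nbrs x) <= 2 * #|` A|)%N) ->
  (forall t A, 0 <= t -> u t A <= 1) ->
  (forall A, A != fset0 -> u 0 A <= K * harm A) ->
  (forall A e, 0 < e -> exists2 d, 0 < d & forall h, 0 < h < d -> forall t, 0 <= t ->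
    u (t + h) A <= u t A + h * dual_gen (u t) A + h * e) ->
  forall t A, 0 <= t -> A != fset0 -> u t A <= K * expR (- decay * t) * harm A.
Proof.
move=> N1 c0 K0 inner u1 u0 ustep t A t0 A0.
have lam0 : 0 < lam by exact: lt_trans th_lt_lam.
have harm0 B : 0 <= harm B by rewrite invr_ge0.
have W0 B : 0 <= weight B by apply: sumr_ge0 => x _; exact: le_trans ler01 (w_ge1 x).
move: t0; rewrite le_eqVlt => /orP[/eqP <-|t0].
  by rewrite mulr0 expR0 mulr1 u0.
suff key e : 0 < e ->
    u t A <= K * expR (- decay * t) * harm A + e * (expR (2 * lam * t) * weight A + t).
  apply/ler_addgt0Pr => e e0; set C := expR (2 * lam * t) * weight A + t in key.
  have C0 : 0 < C by rewrite ltr_wpDl // mulr_ge0 // expR_ge0.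
  apply: le_trans (key (e / C) _) _; first exact: divr_gt0.
  by rewrite divfK // gt_eqF.
move=> e0.
have [s sP] := weight_finite e^-1.
have [d d0 dP] := uniform_radius s (fun B => ustep B e e0).
pose r := Num.min d (Num.min (e / lam) decay^-1).
have r0 : 0 < r by rewrite !lt_min d0 divr_gt0 // invr_gt0.
pose n := (Num.truncn (t / r)).+1; pose h := t / n%:R.
have n0 : 0 < n%:R :> R by rewrite ltr0n.
have h0 : 0 < h by rewrite divr_gt0.
have hr : h < r.
  by rewrite /h ltr_pdivrMr // mulrC -ltr_pdivrMr // truncnS_gt.
have [hd hl hc] : [/\ h < d, h < e / lam & h < decay^-1].
  by move: hr; rewrite !lt_min => /and3P[].
have ch1 : decay * h <= 1.
  by rewrite mulrC -ler_pdivlMr // mul1r ltW.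
suff main k B : B != fset0 -> u (k%:R * h) B <=
    K * (1 - decay * h) ^+ k * harm B + e * (1 + 2 * lam * h) ^+ k * weight B +
    k%:R * h * e.
  have nh : n%:R * h = t by rewrite /h mulrC divfK // gt_eqF.
  have := main n A A0; rewrite nh => /le_trans; apply.
  rewrite mulrDr addrA [e * t]mulrC lerD2r; apply: lerD.
    rewrite ler_wpM2r // ler_wpM2l // -nh.
    have -> : - decay * (n%:R * h) = n%:R * - (decay * h) by ring.
    rewrite expRM_natl lerXn2r ?nnegrE ?expR_ge0 ?subr_ge0 //.
    exact: expR_ge1Dx.
  rewrite [X in _ <= X]mulrA ler_wpM2r // ler_wpM2l ?(ltW e0) // -nh.
  have -> : 2 * lam * (n%:R * h) = n%:R * (2 * lam * h) by ring.
  rewrite expRM_natl lerXn2r ?nnegrE ?expR_ge0 //.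
    by rewrite addr_ge0 // !mulr_ge0 // ltW.
  exact: expR_ge1Dx.
have kh0 j : 0 <= j%:R * h by rewrite mulr_ge0 // ltW.
elim: k B => [|k IH] B B0.
  rewrite !mul0r !expr0 !mulr1 addr0; apply: le_trans (u0 _ B0) _.
  by rewrite lerDl mulr_ge0 // ltW.
have [We|eW] := leP (weight B) e^-1; last first.
  apply: le_trans (u1 _ _ (kh0 _)) _.
  have e1 : 1 <= e * weight B by rewrite mulrC -ler_pdivrMr // div1r ltW.
  apply: le_trans (_ : e * (1 + 2 * lam * h) ^+ k.+1 * weight B <= _).
    apply: le_trans e1 _; rewrite ler_wpM2r // ler_peMr ?(ltW e0) // exprn_ege1 //.
    by rewrite lerDl !mulr_ge0 // ltW.
  rewrite -addrA addrCA lerDl addr_ge0 //.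
    by rewrite !mulr_ge0 // exprn_ge0 // subr_ge0.
  by rewrite mulr_ge0 // ltW.
have hB : h * (lam * #|` B|%:R) <= 1.
  apply: le_trans (_ : e / lam * (lam * e^-1) <= _).
    apply: ler_pM; rewrite ?(ltW h0) ?(ltW hl) ?mulr_ge0 ?(ltW lam0) //.
    by rewrite ler_wpM2l ?(ltW lam0) //; apply: le_trans We; exact: weight_card.
  by rewrite mulrA divfK ?gt_eqF // divff // gt_eqF.
have h0d : 0 < h < d by rewrite h0.
have -> : k.+1%:R * h = k%:R * h + h by rewrite -[k.+1]addn1 natrD mulrDl mul1r.
apply: le_trans (dP B h (sP _ We) h0d _ (kh0 k)) _.
rewrite [(_ + h) * e]mulrDl [X in _ <= X]addrA lerD2r.
apply: le_trans (euler_step_le (ltW h0) hB IH B0) _.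
rewrite dual_gen_linear.
have a0 : 0 <= h * (K * (1 - decay * h) ^+ k).
  apply: (mulr_ge0 (ltW h0)); apply: (mulr_ge0 K0).
  by apply: exprn_ge0; rewrite subr_ge0.
have b0 : 0 <= h * (e * (1 + 2 * lam * h) ^+ k).
  apply: (mulr_ge0 (ltW h0)); apply: (mulr_ge0 (ltW e0)).
  by apply: exprn_ge0; rewrite addr_ge0 // !mulr_ge0 // ltW.
have := ler_wpM2l a0 (dual_gen_harm N1 B0 (inner B)).
have := ler_wpM2l b0 (dual_gen_weight B).
rewrite !exprS; set p1 := (_ ^+ k); set p2 := (_ ^+ k); lra.
Qed.

End Dual.

(** * Expectations under the semigroup *)

Lemma expr_le_harmonic (R : realFieldType) (p : R) (n : nat) :
  0 < p < 1 -> (1 - p) ^+ n <= p^-1 * (n.+1%:R)^-1.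
Proof.
move=> /andP[p0 p1].
have bern : (1 - p) ^+ n * (1 + n%:R * p) <= 1.
  elim: n => [|n IH]; first by rewrite expr0 mul0r addr0 mul1r.
  apply: le_trans IH; rewrite exprSr -mulrA ler_wpM2l //.
    by rewrite exprn_ge0 // subr_ge0 ltW.
  rewrite -[n.+1]addn1 natrD; have : 0 <= n%:R :> R by []; nra.
rewrite -invfM -div1r ler_pdivlMr ?mulr_gt0 //.
apply: le_trans bern; rewrite ler_wpM2l //.
  by rewrite exprn_ge0 // subr_ge0 ltW.
by rewrite -[n.+1]addn1 natrD; lra.
Qed.

Section Semigroup.
Variables (R : realType) (V : countType) (nbrs : V -> seq V) (N : nat).
Variables (lam th : R) (T : R -> ((V -> bool) -> R) -> ((V -> bool) -> R)).
Hypothesis TP : bv_semigroup nbrs lam th T.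
Variable mu : probability (config V) R.
Implicit Types (f g : (V -> bool) -> R) (A B : {fset V}).

Definition mean t f : R := \int[mu]_eta T t f eta.

Lemma mean_linear t f g c : 0 <= t -> pcont f -> pcont g ->
  mean t (fun eta => f eta + c * g eta) = mean t f + c * mean t g.
Proof.
move=> t0 cf cg; case: TP => [Tc [_ [_ [Tlin _]]]]; rewrite /mean Tlin //.
have iT k : pcont k -> mu.-integrable setT (EFin \o (T t k : config V -> R)).
  by move=> ck; apply: pcont_integrable; exact: Tc.
rewrite RintegralD //=; last 2 first.
- exact: iT.
- apply: (@pcont_integrable _ _ mu (fun eta => c * T t g eta)).
  rewrite (_ : (fun _ => _) = fun eta => 0 + c * T t g eta).
    by apply: pcontD; [exact: pcont_cst|exact: Tc].
  by apply: funext => eta; rewrite add0r.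
by rewrite RintegralZl //; exact: iT.
Qed.

Lemma mean_ge0 t f : 0 <= t -> pcont f -> (forall eta, 0 <= f eta) -> 0 <= mean t f.
Proof.
move=> t0 cf f0; case: TP => [_ [_ [_ [_ [Tpos _]]]]].
by apply: Rintegral_ge0 => eta _; exact: Tpos.
Qed.

Lemma mean_cst t c : 0 <= t -> mean t (fun=> c) = c.
Proof.
move=> t0; case: TP => [_ [_ [_ [Tlin [_ [T1 _]]]]]].
rewrite /mean (_ : (fun=> c) = (fun eta : V -> bool => 1 + (c - 1) * 1)); last first.
  by apply: funext => eta; ring.
rewrite Tlin //; try exact: pcont_cst.
rewrite T1 // Rintegral_cst //= probability_setT /= mulr1; ring.
Qed.

Lemma mean_le t f g : 0 <= t -> pcont f -> pcont g ->
  (forall eta, f eta <= g eta) -> mean t f <= mean t g.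
Proof.
move=> t0 cf cg fg.
have := @mean_ge0 t (fun eta => g eta + (-1) * f eta) t0 (pcontD _ cg cf).
rewrite mean_linear // => H; rewrite -subr_ge0 -mulN1r; apply: H => eta.
by rewrite mulN1r subr_ge0.
Qed.

Lemma mean_sum t (I : Type) (r : seq I) (G : I -> (V -> bool) -> R) :
  0 <= t -> (forall i, pcont (G i)) ->
  mean t (fun eta => \sum_(i <- r) G i eta) = \sum_(i <- r) mean t (G i).
Proof.
move=> t0 cG; elim: r => [|i r IH].
  rewrite big_nil -[RHS](mean_cst 0 t0); congr mean.
  by apply: funext => eta; rewrite big_nil.
rewrite big_cons -IH -[X in _ = _ + X]mul1r -mean_linear //; last exact: pcont_sum.
by congr mean; apply: funext => eta; rewrite big_cons mul1r.
Qed.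

Lemma mean_dist t f (a e : R) g : 0 <= t -> pcont f -> pcont g ->
  (forall eta, `|f eta - a| <= e + g eta) -> `|mean t f - a| <= e + mean t g.
Proof.
move=> t0 cf cg fg; rewrite ler_distl.
have cl c : pcont (fun eta => e + c + 1 * g eta) by apply: pcontD => //; exact: pcont_cst.
have mg c : mean t (fun eta => e + c + 1 * g eta) = e + c + mean t g.
  by rewrite mean_linear ?mean_cst ?mul1r //; exact: pcont_cst.
have H1 : mean t f <= e + a + mean t g.
  by rewrite -mg; apply: mean_le => // eta; have := fg eta; rewrite ler_distl; lra.
have H2 : a <= mean t f + (e + mean t g).
  rewrite -{1}(mean_cst a t0).
  have -> : mean t f + (e + mean t g) =
      mean t (fun eta => f eta + 1 * (e + 0 + 1 * g eta)).
    by rewrite mean_linear // mg addr0 mul1r.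
  apply: mean_le => //; [exact: pcont_cst|exact: pcontD|] => eta.
  by have := fg eta; rewrite ler_distl; lra.
apply/andP; split; lra.
Qed.

Lemma mean_euler F f e : uniq F -> depends_on F f -> 0 < e ->
  pcont (bv_gen nbrs lam th F f) ->
  exists2 d, 0 < d & forall h, 0 < h < d -> forall t, 0 <= t ->
    mean (t + h) f <= mean t f + h * mean t (bv_gen nbrs lam th F f) + h * e.
Proof.
move=> uF fF e0 cL; have cf := depends_on_pcont fF.
case: TP => [Tc [_ [TD [_ [_ [_ [_ Tgen]]]]]]].
have [d d0 H] := Tgen F f uF fF e e0; exists d => // h /andP[h0 hd] t t0.
have -> : mean (t + h) f = mean t (T h f) by rewrite /mean TD // ltW.
have cLf := pcontD h cf cL.
rewrite -[h * e](mean_cst _ t0) -[X in _ <= _ + X]mul1r -mean_linear //.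
rewrite -mean_linear //; last exact: pcont_cst.
apply: mean_le => //; [by apply: Tc; rewrite ?ltW|by apply: pcontD => //; exact: pcont_cst|].
move=> eta; have := H h eta h0 hd; rewrite ltr_distl => /andP[_].
by rewrite ltr_pdivrMr // mul1r; lra.
Qed.

Lemma pcont_vacant A : pcont (vacant R A).
Proof. exact: (depends_on_pcont (@depends_on_vacant R V A)). Qed.
Arguments pcont_vacant : clear implicits.

Lemma mean_dual_term t f g k a b : 0 <= t -> pcont f -> pcont g -> pcont k ->
  let F := fun eta => a * (f eta - k eta) + b * (g eta - k eta) in
  pcont F /\ mean t F = a * (mean t f - mean t k) + b * (mean t g - mean t k).
Proof.
move=> t0 cf cg ck F.
have FE : F = fun eta => 0 + a * f eta + b * g eta + (- (a + b)) * k eta.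
  by apply: funext => eta; rewrite /F; ring.
have c1 : pcont (fun eta => 0 + a * f eta) by apply: pcontD => //; exact: pcont_cst.
have c2 := pcontD b c1 cg.
split; first by rewrite FE; exact: pcontD.
rewrite FE !mean_linear ?mean_cst //; [ring|exact: pcont_cst].
Qed.

Hypothesis size_nbrs : forall x, size (nbrs x) = N.+1.

Lemma mean_bv_gen_vacant t A : 0 <= t ->
  pcont (bv_gen nbrs lam th A (vacant R A)) /\
  mean t (bv_gen nbrs lam th A (vacant R A)) =
  dual_gen nbrs N lam th (fun B => mean t (vacant R B)) A.
Proof.
move=> t0; have -> : bv_gen nbrs lam th A (vacant R A) =
    fun eta => dual_gen nbrs N lam th (fun B => vacant R B eta) A.
  by apply: funext => eta; exact: bv_gen_vacant.
pose G x y eta : R :=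
  th / N.+1%:R * (vacant R (y |` (A `\ x))%fset eta - vacant R A eta) +
  (lam - th) / N.+1%:R * (vacant R (y |` A)%fset eta - vacant R A eta).
have GP x y := mean_dual_term (th / N.+1%:R) ((lam - th) / N.+1%:R) t0
  (pcont_vacant (y |` (A `\ x))%fset) (pcont_vacant (y |` A)%fset) (pcont_vacant A).
have cG x y : pcont (G x y) := (GP x y).1.
have cG2 x : pcont (fun eta => \sum_(y <- nbrs x) G x y eta) by exact: pcont_sum.
split; first exact: (pcont_sum _ cG2).
rewrite (mean_sum _ t0 cG2); apply: eq_bigr => x _.
rewrite (mean_sum _ t0 (cG x)); apply: eq_bigr => y _.
exact: (GP x y).2.
Qed.

Lemma mean0_vacant p A : bernoulli_product p mu -> mean 0 (vacant R A) = (1 - p) ^+ #|` A|.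
Proof.
move=> /(_ [seq (x, false) | x <- A]) mup.
case: TP => [_ [T0 _]]; rewrite /mean T0; last exact: pcont_vacant.
set S := [set eta | _] in mup.
have SE (eta : config V) : vacant R A eta = \1_S eta.
  rewrite /vacant indicE; congr (nat_of_bool _)%:R.
  apply/allP/idP => [H|/set_mem H x xA].
    by apply/mem_set => _ /mapP[x xA ->] /=; apply/negbTE; exact: H.
  by apply/negbT; apply: (H (x, false)); apply: map_f.
have mS : measurable (S : set (config V)).
  have := pcont_measurable (pcont_vacant A) measurableT.
  move=> /(_ [set 1] (measurable_set1 1)); rewrite setTI; congr measurable.
  apply/seteqP; split => eta /=; rewrite SE indicE.
    by case: (boolP (eta \in S)) => [/set_mem//|_ /eqP]; rewrite eq_sym oner_eq0.
  by move=> /mem_set ->.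
rewrite /Rintegral; under eq_integral do rewrite SE.
rewrite integral_indic // setIT -[RHS]/(fine ((1 - p) ^+ #|` A|)%:E); congr fine.
apply: etrans (mup _) _; first by rewrite -map_comp (@eq_map _ _ _ id) // map_id fset_uniq.
by rewrite big_map /= big_const_seq count_predT iter_mulr_1.
Qed.

End Semigroup.

(** * The regular tree *)

Section Tree.
Variable N : nat.
Implicit Types x y : tree N.

Definition tree_kids x : seq (tree N) :=
  pmap insub [seq rcons (val x) i | i <- iota 0 N.+1].

Definition tree_parents x : seq (tree N) :=
  pmap insub (if val x is [::] then [::] else [:: take (size (val x)).-1 (val x)]).

Lemma tree_nbrsE x : tree_nbrs x = tree_parents x ++ tree_kids x.
Proof. exact: pmap_cat. Qed.

Lemma tree_word_rcons s i : tree_word N (rcons s i) =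
  tree_word N s && (i < (if s is [::] then N.+1 else N))%N.
Proof.
case: s => [|a s] /=; first by rewrite andbT.
by rewrite all_rcons -andbA [X in _ && X]andbC.
Qed.

Lemma mem_tree_kids x y : y \in tree_kids x ->
  exists2 i, (i < N.+1)%N & val y = rcons (val x) i.
Proof.
rewrite mem_pmap_sub => /mapP[i]; rewrite mem_iota add0n => iN ->.
by exists i.
Qed.

Lemma mem_tree_parents x y : y \in tree_parents x ->
  exists2 i, (i < N.+1)%N & val x = rcons (val y) i.
Proof.
rewrite mem_pmap_sub; case: x => s /= ss.
case/lastP: s ss => [//|s i]; rewrite tree_word_rcons => /andP[_ iN].
have -> : (if rcons s i is [::] then [::] else [:: take (size (rcons s i)).-1 (rcons s i)])
    = [:: s] by rewrite size_rcons /= -cats1 take_size_cat //; case: s {iN}.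
rewrite inE => /eqP ->; exists i => //.
by case: s iN => // a s iN; apply: ltnW.
Qed.

Lemma size_tree_nbrs x : size (tree_nbrs x) = N.+1.
Proof.
rewrite tree_nbrsE size_cat !size_pmap_sub; move: (val x) (valP x) => s ss.
have -> : count (tree_word N) [seq rcons s i | i <- iota 0 N.+1] =
    (if s is [::] then N.+1 else N).
  rewrite count_map (eq_count (a2 := fun i => i < (if s is [::] then N.+1 else N))%N);
    last by move=> i /=; rewrite tree_word_rcons ss.
  case: s ss => [|a s] _.
    rewrite -[RHS](size_iota 0 N.+1); apply/eqP; rewrite -all_count.
    by apply/allP => i; rewrite mem_iota.
  rewrite -[N.+1]addn1 iotaD count_cat /= add0n ltnn addn0 -[RHS](size_iota 0 N) addn0.
  by apply/eqP; rewrite -all_count; apply/allP => i; rewrite mem_iota.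
case/lastP: s ss => [//|s i]; rewrite tree_word_rcons => /andP[ss _].
rewrite size_rcons -cats1 take_size_cat //.
by case: s ss => [|a s] //= ->.
Qed.

Lemma tree_nbrs_irr x : x \notin tree_nbrs x.
Proof.
rewrite tree_nbrsE mem_cat negb_or; apply/andP; split; apply/negP.
  by move=> /mem_tree_parents[i _ /(congr1 size)]; rewrite size_rcons; lia.
by move=> /mem_tree_kids[i _ /(congr1 size)]; rewrite size_rcons; lia.
Qed.

Lemma size_tree_nbr x y : y \in tree_nbrs x -> (size (val y) <= (size (val x)).+1)%N.
Proof.
rewrite tree_nbrsE mem_cat => /orP[/mem_tree_parents|/mem_tree_kids] [i _ ->];
  by rewrite size_rcons; lia.
Qed.

Lemma tree_kids_uniq x : uniq (tree_kids x).
Proof.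
apply: pmap_sub_uniq; rewrite map_inj_uniq ?iota_uniq // => i j.
by move=> /(congr1 (last 0%N)); rewrite !last_rcons.
Qed.

Lemma count_mem_exchange (T : choiceType) (A : {fset T}) (s : seq T) : uniq s ->
  count (mem A) s = (\sum_(y <- A) (y \in s))%N.
Proof.
move=> us; rewrite -sumn_count sumnE big_map.
under [RHS]eq_bigr => y do rewrite -(count_uniq_mem _ us) -sumn_count sumnE big_map.
rewrite exchange_big /=; apply: eq_bigr => y _.
under eq_bigr => z do rewrite eq_sym.
by rewrite -(count_uniq_mem _ (fset_uniq A)) -sumn_count sumnE big_map.
Qed.

Lemma tree_inner_edges (A : {fset tree N}) :
  (\sum_(x <- A) count (mem A) (tree_nbrs x) <= 2 * #|` A|)%N.
Proof.
under eq_bigr do rewrite tree_nbrsE count_cat.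
have card1 : (\sum_(x <- A) 1 = #|` A|)%N by rewrite sum1_size.
rewrite big_split /= mul2n -addnn -{1}card1 -card1; apply: leq_add.
  apply: leq_sum => x _; apply: leq_trans (count_size _ _) _.
  by rewrite size_pmap_sub; apply: leq_trans (count_size _ _) _; case: (val x).
under eq_bigr do rewrite count_mem_exchange ?tree_kids_uniq //.
rewrite exchange_big /=; apply: leq_sum => y _.
have -> : (\sum_(x <- A) (y \in tree_kids x) = count (fun x => y \in tree_kids x) A)%N.
  by rewrite -sumn_count sumnE big_map.
have [/hasP[x _ yx]|] := boolP (has (fun x => y \in tree_kids x) A); last first.
  by rewrite has_count -eqn0Ngt => /eqP ->.
apply: leq_trans (_ : count_mem x A <= 1)%N; last by rewrite count_uniq_mem ?fset_uniq ?leq_b1.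
apply: sub_count => z /mem_tree_kids[i _ zi] /=; have [j _ xj] := mem_tree_kids yx.
by apply/eqP/val_inj; move: zi; rewrite xj => /rcons_inj[].
Qed.

Lemma tree_ball_finite (m : nat) :
  exists s : seq (tree N), forall x, (size (val x) <= m)%N -> x \in s.
Proof.
elim: m => [|m [s IH]].
  exists [:: exist _ [::] isT] => x; rewrite leqn0 => /nilP x0.
  by rewrite inE; apply/eqP/val_inj; rewrite x0.
exists (s ++ flatten (map tree_kids s)) => x; rewrite leq_eqVlt => /orP[/eqP xm|];
  last by rewrite ltnS mem_cat => /IH ->.
rewrite mem_cat; apply/orP; right.
case: x xm => t /=; case/lastP: t => // t i ti; rewrite size_rcons => -[tm].
have /andP[tt iN] := etrans (esym (tree_word_rcons t i)) ti.
apply/flatten_mapP; exists (exist _ t tt); first by apply: IH; rewrite /= tm.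
rewrite mem_pmap_sub; apply/mapP; exists i => //; rewrite mem_iota add0n.
by case: (t) iN => // a l; exact: ltnW.
Qed.

End Tree.

(** * Convergence *)

Lemma limn_esup_le (R : realType) (u : nat -> \bar R) (l : \bar R) :
  (\forall n \near \oo, (u n <= l)%E) -> (limn_esup u <= l)%E.
Proof.
move=> [m _ um]; rewrite limn_esup_lim; apply: lime_le; first exact: is_cvg_esups.
exists m => // n /= mn; apply: ge_ereal_sup => _ [k /= nk <-].
by apply: um; exact: leq_trans nk.
Qed.

Lemma decay_gt0 (R : realType) (N : nat) (lam th : R) :
  (1 < N)%N -> 0 < th -> 7 < lam / th -> 0 < decay N lam th.
Proof.
move=> N1 th0; rewrite ltr_pdivlMr // => lt7.
have N2 : 2 <= N%:R :> R by rewrite ler_nat.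
rewrite /decay divr_gt0 // subr_gt0.
nra.
Qed.

Section Convergence.
Variables (R : realType) (N : nat) (lam th : R).
Hypothesis N_gt1 : (1 < N)%N.
Hypothesis th_gt0 : 0 < th.
Hypothesis th_lt_lam : th < lam.
Hypothesis decay_pos : 0 < decay N lam th.
Variable T : R -> ((tree N -> bool) -> R) -> ((tree N -> bool) -> R).
Hypothesis TP : bv_semigroup (@tree_nbrs N) lam th T.
Variable p : R.
Hypothesis p01 : 0 < p < 1.
Variable mu : probability (config (tree N)) R.
Hypothesis mup : bernoulli_product p mu.

Lemma mean_vacant_decay t (A : {fset tree N}) : 0 <= t -> A != fset0 ->
  mean T mu t (vacant R A) <= p^-1 * expR (- decay N lam th * t).
Proof.
move=> t0 A0; have /andP[p0 _] := p01.
pose w (x : tree N) : R := (size (val x)).+1%:R.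
have w1 x : 1 <= w x by rewrite ler1n.
have wn x y : y \in tree_nbrs x -> w y <= w x + 1.
  by move=> /size_tree_nbr yx; rewrite /w natr1 ler_nat ltnS.
have wf (m : R) : exists s : seq (tree N), forall x, w x <= m -> x \in s.
  have [s sP] := tree_ball_finite N (Num.truncn m); exists s => x xm; apply: sP.
  rewrite -ltnS -(ltr_nat R); apply: le_lt_trans (truncnS_gt m).
  by apply: le_trans xm; rewrite ler_nat.
have step (B : {fset tree N}) e : 0 < e -> exists2 d, 0 < d & forall h, 0 < h < d ->
    forall s, 0 <= s -> mean T mu (s + h) (vacant R B) <= mean T mu s (vacant R B) +
      h * dual_gen (@tree_nbrs N) N lam th (fun C => mean T mu s (vacant R C)) B + h * e.
  move=> e0.
  have gP s := mean_bv_gen_vacant TP mu (@size_tree_nbrs N) (t := s) B.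
  have [d d0 H] := mean_euler TP mu (fset_uniq B) (@depends_on_vacant R _ B) e0
    (gP 0 (lexx 0)).1.
  by exists d => // h hd s s0; rewrite -(gP s s0).2; exact: H.
have := dual_decay th_gt0 th_lt_lam (@size_tree_nbrs N) (@tree_nbrs_irr N) w1 wn wf
  (u := fun s B => mean T mu s (vacant R B)) (K := p^-1) N_gt1 decay_pos _
  (@tree_inner_edges N) _ _ step t0 A0.
move=> H; apply: le_trans (H _ _ _) _.
- by rewrite invr_ge0 ltW.
- move=> s B s0; rewrite -[X in _ <= X](mean_cst TP mu 1 s0).
  apply: (mean_le TP) => //; [exact: pcont_vacant|exact: pcont_cst|] => eta.
  by rewrite /vacant lern1 leq_b1.
- by move=> B _; rewrite (mean0_vacant TP _ mup) expr_le_harmonic.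
- rewrite ler_piMr // ?mulr_ge0 ?invr_ge0 ?expR_ge0 ?(ltW p0) //.
  by rewrite invf_le1 // ler1n.
Qed.

Lemma mean_cvg (f : (tree N -> bool) -> R) : pcont f ->
  mean T mu t f @[t --> +oo] --> f (fun=> true).
Proof.
move=> cf; have /andP[p0 _] := p01; set c := decay N lam th.
have c0 : 0 < c by exact: decay_pos.
apply/cvgrPdist_le => e e0.
have e20 : 0 < e / 2 by rewrite divr_gt0.
have [F FP] := pcont_nbhd (fun=> true) cf e20.
have [M M0 fM] := pcont_bounded cf.
pose C := 2 * M * ((size F)%:R * p^-1).
have C0 : 0 <= C by rewrite !mulr_ge0 ?invr_ge0 // ltW.
near=> t.
have t0 : 0 < t by near: t; exact: nbhs_pinfty_gt.
have tC : C / (e / 2 * c) <= t by near: t; apply: nbhs_pinfty_ge; exact: num_real.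
pose g eta : R := 0 + 2 * M * \sum_(x <- F) vacant R [fset x]%fset eta.
have cs : pcont (fun eta => \sum_(x <- F) vacant R [fset x]%fset eta).
  by apply: pcont_sum => x; exact: pcont_vacant.
have cg : pcont g by apply: pcontD => //; exact: pcont_cst.
have vE x eta : vacant R [fset x]%fset eta = (~~ eta x)%:R.
  by rewrite -[[fset x]%fset]fsetU0 vacantU1 /vacant /= mulr1.
have fg eta : `|f eta - f (fun=> true)| <= e / 2 + g eta.
  rewrite /g add0r; have [/allP Feta|/allPn[x xF ex]] := boolP (all eta F).
    apply: ler_wpDr; last by apply/ltW/FP => x /Feta ->.
    by rewrite !mulr_ge0 ?(ltW M0) // sumr_ge0 // => x _; rewrite vE.
  apply: le_trans (_ : 2 * M <= _).
    apply: le_trans (ler_normB _ _) _.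
    by have := fM eta; have := fM (fun=> true); lra.
  apply: ler_wpDl; first exact: ltW.
  rewrite ler_peMr ?mulr_ge0 ?(ltW M0) // (big_rem x) //= vE ex lerDl sumr_ge0 //.
rewrite distrC; apply: le_trans (mean_dist TP mu (ltW t0) cf cg fg) _.
rewrite [X in _ <= X](_ : e = e / 2 + e / 2); last by field.
rewrite lerD2l /g (mean_linear TP) ?(ltW t0) //; last exact: pcont_cst.
rewrite (mean_cst TP) ?(ltW t0) // add0r (mean_sum TP) ?(ltW t0) //; last first.
  by move=> x; exact: pcont_vacant.
apply: le_trans (_ : C * expR (- c * t) <= _).
  rewrite /C -!mulrA ler_wpM2l // ler_wpM2l ?(ltW M0) //.
  have -> : (size F)%:R * (p^-1 * expR (- c * t)) = \sum_(x <- F) p^-1 * expR (- c * t).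
    by rewrite big_const_seq count_predT iter_addr_0 mulr_natl.
  apply: ler_sum => x _; apply: mean_vacant_decay (ltW t0) _.
  by apply/fset0Pn; exists x; rewrite inE.
rewrite mulNr expRN ler_pdivrMr ?expR_gt0 //.
apply: le_trans (_ : e / 2 * (c * t) <= _); last first.
  rewrite ler_wpM2l ?(ltW e20) //; apply: le_trans (expR_ge1Dx _).
  by rewrite lerDr.
have -> : e / 2 * (c * t) = t * (e / 2 * c) by ring.
by rewrite -(ler_pdivrMr _ _ (mulr_gt0 e20 c0)).
Unshelve. all: by end_near. Qed.

End Convergence.

Theorem theorem2p2 (R : realType) :
  exists A : nat -> R,
    (forall N : nat, (2 <= N)%N -> 0 < A N) /\
    (limn_esup (fun N : nat => (A N / Num.sqrt (N%:R))%:E) <= 1%:E)%E /\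
    forall N : nat, (2 <= N)%N ->
    forall lam th : R, 0 < th -> th < lam -> A N < lam / th ->
    forall T : R -> ((tree N -> bool) -> R) -> ((tree N -> bool) -> R),
      bv_semigroup (@tree_nbrs N) lam th T ->
    forall p : R, 0 < p < 1 ->
    forall mu : probability (config (tree N)) R,
      bernoulli_product p mu ->
    forall f : (tree N -> bool) -> R, pcont f ->
      (\int[mu]_eta (T t f eta)%:E)%E @[t --> +oo] --> ((f (fun _ => true))%:E)%E.
Proof.
exists (fun=> 7); split=> [//|]; split.
  apply: limn_esup_le; exists 49%N => // n /= n49.
  have s7 : 7 <= Num.sqrt (n%:R : R).
    by rewrite -[7]ger0_norm // -sqrtr_sqr ler_sqrt // -natrX ler_nat.
  by rewrite lee_fin ler_pdivrMr ?mul1r // (lt_le_trans _ s7).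
move=> N N2 lam th th0 thl lt7 T TP p p01 mu mup f cf.
have dpos := decay_gt0 N2 th0 lt7.
apply/fine_cvgP; split; last exact: (mean_cvg N2 th0 thl dpos TP p01 mup cf).
near=> t; apply: integrable_fin_num => //.
have Tc : pcont (T t f).
  by case: TP => [H _]; apply: H => //; near: t; exact: nbhs_pinfty_ge.
exact: (pcont_integrable mu Tc).
Unshelve. all: by end_near. Qed.
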